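(* Let $\mathfrak{F},\mathfrak{H}$ be clonable families of $r$-graphs. Let $\mathfrak{F}^*$ consist of all $r$-graphs in $\mathfrak{F}$ that cover pairs. If $\mathfrak{F}^*$ is $\mathfrak{H}$-weakly weight stable and $\mathfrak{F}$ is $\mathfrak{H}$-locally stable, then $\mathfrak{F}$ is $\mathfrak{H}$-stable.
   Context: An $r$-graph is a finite $r$-uniform hypergraph $\mathcal{F}$, identified with its edge set; $V(\mathcal{F})$ is its vertex set, $\mathrm{v}(\mathcal{F})=|V(\mathcal{F})|$, and $|\mathcal{F}|$ is its number of edges. Isomorphic $r$-graphs are not distinguished (families are closed under isomorphism). $\mathcal{F}$ covers pairs if for every two distinct $u,v\in V(\mathcal{F})$ some edge contains both. Cloning a vertex $v$ of $\mathcal{F}$ to a set $W\ni v$ (with $W\cap V(\mathcal{F})=\{v\}$) produces the $r$-graph on $V(\mathcal{F})\cup W$ whose edges are the edges of $\mathcal{F}$ not containing $v$ and all sets $\{w\}\cup I$ with $w\in W$, $v\notin I$, $\{v\}\cup I\in\mathcal{F}$. A blowup of $\mathcal{F}$ is an $r$-graph isomorphic to one obtained from $\mathcal{F}$ by repeatedly cloning and deleting vertices. A family is clonable if every blowup of each of its members lies in the family. Put $m(\mathfrak{H},n):=\max\{|\mathcal{H}|:\mathcal{H}\in\mathfrak{H},\ \mathrm{v}(\mathcal{H})=n\}$ and $d_{\mathfrak{H}}(\mathcal{F}):=\min|\mathcal{F}\triangle\mathcal{H}|$ over $\mathcal{H}\in\mathfrak{H}$ with $V(\mathcal{H})=V(\mathcal{F})$.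 For $\varepsilon,\alpha>0$, $\mathfrak{F}$ is $(\mathfrak{H},\varepsilon,\alpha)$-locally stable if there is $n_0$ such that every $\mathcal{F}\in\mathfrak{F}$ with $\mathrm{v}(\mathcal{F})=n\ge n_0$ and $d_{\mathfrak{H}}(\mathcal{F})\le\varepsilon n^r$ satisfies $|\mathcal{F}|\le m(\mathfrak{H},n)-\alpha d_{\mathfrak{H}}(\mathcal{F})$. $\mathfrak{F}$ is $\mathfrak{H}$-locally stable if this holds for some $\varepsilon,\alpha>0$; $\mathfrak{F}$ is $\mathfrak{H}$-stable if it is $(\mathfrak{H},1,\alpha)$-locally stable for some $\alpha>0$, i.e. for some $\alpha>0$ and $n_0$ the inequality holds for all $\mathcal{F}\in\mathfrak{F}$ with $n\ge n_0$. Weighted notions. $\mathcal{M}(\mathcal{F})$ is the set of probability distributions $\mu:V(\mathcal{F})\to[0,1]$; $(\mathcal{F},\mu)$ with $\mu\in\mathcal{M}(\mathcal{F})$ is a weighted $r$-graph, with density $\lambda(\mathcal{F},\mu):=\sum_{F\in\mathcal{F}}\prod_{v\in F}\mu(v)$. $\lambda(\mathcal{F}):=\max_{\mu\in\mathcal{M}(\mathcal{F})}\lambda(\mathcal{F},\mu)$ and $\lambda(\mathfrak{H}):=\sup_{\mathcal{H}\in\mathfrak{H}}\lambda(\mathcal{H})$. If $\mathcal{F}'$ is obtained from $\mathcal{F}$ by cloning $u$ to $W$, then $(\mathcal{F}',\mu')$ is a one vertex blowup of $(\mathcal{F},\mu)$ if $\mu'=\mu$ on $V(\mathcal{F})\setminus\{u\}$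 and $\sum_{w\in W}\mu'(w)=\mu(u)$; a blowup of $(\mathcal{F},\mu)$ is a weighted $r$-graph isomorphic to one obtained by repeatedly taking one vertex blowups. The distance $d((\mathcal{F}_1,\mu_1),(\mathcal{F}_2,\mu_2))$ is the infimum of $\sum_{F\in\mathcal{F}_1'\triangle\mathcal{F}_2'}\prod_{v\in F}\mu(v)$ over all $\mathcal{F}_1',\mathcal{F}_2'$ on a common vertex set and all $\mu$ such that $(\mathcal{F}_i',\mu)$ is a blowup of $(\mathcal{F}_i,\mu_i)$ for $i=1,2$. Put $d_{\mathfrak{H}}(\mathcal{F},\mu):=\inf d((\mathcal{F},\mu),(\mathcal{H},\nu))$ over $\mathcal{H}\in\mathfrak{H}$, $\nu\in\mathcal{M}(\mathcal{H})$. A family $\mathfrak{G}$ is $\mathfrak{H}$-weakly weight stable if for every $\varepsilon>0$ there exists $\delta>0$ such that for every $\mathcal{F}\in\mathfrak{G}$ and $\mu\in\mathcal{M}(\mathcal{F})$, $\lambda(\mathcal{F},\mu)\ge\lambda(\mathfrak{H})-\delta$ implies $d_{\mathfrak{H}}(\mathcal{F},\mu)\le\varepsilon$. *)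

(* Defs.v *)
From mathcomp Require Import all_boot all_order all_algebra.
From mathcomp Require Import all_classical all_reals all_analysis.

Set Implicit Arguments.
Unset Strict Implicit.
Unset Printing Implicit Defensive.

Import Order.TTheory GRing.Theory Num.Theory.

Local Open Scope set_scope.
Local Open Scope ring_scope.

(* A hypergraph with vertex set T is its edge set E : {set {set T}}; vertices  *)
(* of T lying in no edge are allowed and are counted by v(E) = #|T|.           *)
Definition hypergraph_family : Type := forall T : finType, {set {set T}} -> Prop.

Definition uniform (r : nat) (T : finType) (E : {set {set T}}) : Prop :=
  forall e, e \in E -> #|e| = r.

Definition image_edges (T U : finType) (f : T -> U) (E : {set {set T}}) :
  {set {set U}} := [set f @: (e : {set T}) | e in E].

Definition isomorphic (T U : finType) (E : {set {set T}}) (E' : {set {set U}}) :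
  Prop := exists2 f : T -> U, bijective f & E' = image_edges f E.

Definition rgraph_family (r : nat) (FF : hypergraph_family) : Prop :=
  (forall (T : finType) (E : {set {set T}}), FF T E -> uniform r E) /\
  (forall (T U : finType) (E : {set {set T}}) (E' : {set {set U}}),
     isomorphic E E' -> FF T E -> FF U E').

Definition covers_pairs (T : finType) (E : {set {set T}}) : Prop :=
  forall u v : T, u != v -> exists2 e, e \in E & (u \in e) && (v \in e).

Definition covering_pairs (FF : hypergraph_family) : hypergraph_family :=
  fun T E => FF T E /\ covers_pairs E.

Definition symdiff (T : finType) (A B : {set T}) : {set T} :=
  (A :\: B) :|: (B :\: A).

(* Cloning v to W = {v} + X: the new vertices form the finite type X, and the  *)
(* new vertex set is the disjoint union T + X.                                 *)
Definition clone_set (T X : finType) (v : T) : {set T + X} :=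
  inl v |: [set inr x | x in X].

Definition clone (T X : finType) (v : T) (E : {set {set T}}) :
  {set {set T + X}} :=
  image_edges inl [set e in E | v \notin e] :|:
  [set w |: inl @: (I : {set T})
     | w in clone_set X v, I in [set I : {set T} | (v \notin I) && (v |: I \in E)]].

Definition delete (T : finType) (v : T) (E : {set {set T}}) :
  {set {set {x : T | x != v}}} :=
  [set e : {set {x : T | x != v}} | [set val x | x in e] \in E].

Inductive clone_delete (T : finType) (E : {set {set T}}) :
  forall U : finType, {set {set U}} -> Prop :=
| clone_delete_refl : clone_delete E E
| clone_delete_clone (U X : finType) (v : U) (E' : {set {set U}}) :
    clone_delete E E' -> clone_delete E (clone X v E')
| clone_delete_delete (U : finType) (v : U) (E' : {set {set U}}) :
    clone_delete E E' -> clone_delete E (delete v E').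

Definition blowup (T U : finType) (E : {set {set T}}) (E' : {set {set U}}) :
  Prop :=
  exists (S : finType) (D : {set {set S}}), clone_delete E D /\ isomorphic D E'.

Definition clonable (FF : hypergraph_family) : Prop :=
  forall (T U : finType) (E : {set {set T}}) (E' : {set {set U}}),
    FF T E -> blowup E E' -> FF U E'.

(* Families are closed under isomorphism, so the maximum over members of order *)
(* n may be taken over those with vertex set 'I_n.                             *)
Definition max_edges (HH : hypergraph_family) (n : nat) : nat :=
  \max_(E : {set {set 'I_n}} | `[< HH 'I_n E >]) #|E|.

(* The minimum is +oo when HH has no member on the vertex set T; for clonable  *)
(* HH and nonempty T this means that HH has no member with a vertex.           *)
Definition edit_dist (R : realType) (HH : hypergraph_family) (T : finType)
  (E : {set {set T}}) : \bar R :=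
  \big[Order.min/+oo%E]_(E' : {set {set T}} | `[< HH T E' >])
    (#|symdiff E E'|%:R%:E).

Definition locally_stable_with (R : realType) (r : nat) (HH : hypergraph_family)
  (eps alpha : R) (FF : hypergraph_family) : Prop :=
  exists n0 : nat, forall (T : finType) (E : {set {set T}}),
    FF T E -> (n0 <= #|T|)%N ->
    (edit_dist R HH E <= (eps * #|T|%:R ^+ r)%:E)%E ->
    (#|E|%:R%:E <= (max_edges HH #|T|)%:R%:E - alpha%:E * edit_dist R HH E)%E.

Definition locally_stable (R : realType) (r : nat) (HH FF : hypergraph_family) : Prop :=
  exists eps alpha : R,
    [/\ 0 < eps, 0 < alpha & locally_stable_with r HH eps alpha FF].

Definition stable (R : realType) (r : nat) (HH FF : hypergraph_family) : Prop :=
  exists2 alpha : R, 0 < alpha & locally_stable_with r HH 1 alpha FF.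

Definition distribution_on (R : realType) (T : finType) (mu : T -> R) : Prop :=
  (forall x, 0 <= mu x <= 1) /\ \sum_x mu x = 1.

Definition density (R : realType) (T : finType) (E : {set {set T}})
  (mu : T -> R) : R := \sum_(e in E) \prod_(v in e) mu v.

(* A supremum of a continuous function on a simplex, hence a maximum when T is *)
(* nonempty; it is 0 when T is empty.                                          *)
Definition lagrangian (R : realType) (T : finType) (E : {set {set T}}) : R :=
  sup [set density E mu | mu in @distribution_on R T]%classic.

Definition family_lagrangian (R : realType) (HH : hypergraph_family) : R :=
  sup [set l | exists (T : finType) (E : {set {set T}}),
                 HH T E /\ l = lagrangian R E]%classic.

Definition one_vertex_weights (R : realType) (T X : finType) (v : T)
  (mu : T -> R) (mu' : T + X -> R) : Prop :=
  [/\ distribution_on mu',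
      forall x, x != v -> mu' (inl x) = mu x &
      \sum_(w in clone_set X v) mu' w = mu v].

Inductive weighted_clones (R : realType) (T : finType) (E : {set {set T}})
  (mu : T -> R) : forall U : finType, {set {set U}} -> (U -> R) -> Prop :=
| weighted_clones_refl : weighted_clones E mu E mu
| weighted_clones_step (U X : finType) (v : U) (E' : {set {set U}})
    (mu' : U -> R) (nu : U + X -> R) :
    weighted_clones E mu E' mu' -> one_vertex_weights v mu' nu ->
    weighted_clones E mu (clone X v E') nu.

Definition weighted_isomorphic (R : realType) (T U : finType)
  (E : {set {set T}}) (mu : T -> R) (E' : {set {set U}}) (mu' : U -> R) : Prop :=
  exists f : T -> U,
    [/\ bijective f, E' = image_edges f E & forall x, mu' (f x) = mu x].

Definition weighted_blowup (R : realType) (T U : finType)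
  (E : {set {set T}}) (mu : T -> R) (E' : {set {set U}}) (mu' : U -> R) : Prop :=
  exists (S : finType) (D : {set {set S}}) (nu : S -> R),
    weighted_clones E mu D nu /\ weighted_isomorphic D nu E' mu'.

Definition weighted_dist (R : realType) (T1 T2 : finType)
  (E1 : {set {set T1}}) (mu1 : T1 -> R) (E2 : {set {set T2}}) (mu2 : T2 -> R) :
  \bar R :=
  ereal_inf [set d | exists (U : finType) (D1 D2 : {set {set U}}) (mu : U -> R),
    [/\ weighted_blowup E1 mu1 D1 mu, weighted_blowup E2 mu2 D2 mu &
        d = (density (symdiff D1 D2) mu)%:E]]%classic.

Definition family_weighted_dist (R : realType) (HH : hypergraph_family) (T : finType)
  (E : {set {set T}}) (mu : T -> R) : \bar R :=
  ereal_inf [set d | exists (U : finType) (H : {set {set U}}) (nu : U -> R),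
    [/\ HH U H, distribution_on nu & d = weighted_dist E mu H nu]]%classic.

Definition weakly_weight_stable (R : realType) (HH GG : hypergraph_family) : Prop :=
  forall eps : R, 0 < eps -> exists2 delta : R, 0 < delta &
    forall (T : finType) (E : {set {set T}}) (mu : T -> R),
      GG T E -> distribution_on mu ->
      density E mu >= family_lagrangian R HH - delta ->
      (family_weighted_dist HH E mu <= eps%:E)%E.

(* Main.v *)
Require Import Defs.
From mathcomp Require Import all_boot all_order all_algebra all_fingroup.
From mathcomp Require Import all_classical all_reals all_analysis.
From mathcomp Require Import zify lra.

(** The argument is Zykov symmetrization run backwards from a stable endpoint.

    Let [E] in [FF] have [n] vertices and more than [m - beta n^r] edges, where
    [m] is the maximum over [HH]; a sparser [E] satisfies the conclusion
    trivially, since edit distances are at most [n^r].  It suffices to show that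
    [E] is near [HH], in the sense that its edit distance is at most
    [eps / 2 * n^r]: then local stability applies to it.

    Repeatedly replace a vertex [x] by a twin of a nonadjacent vertex [y], the
    two being ordered so that the number of edges does not drop.  This stays
    inside [FF], which is clonable, and can be made to end at a blowup of a member [G] of [FF] covering pairs.
    The density of [G], weighted by its class sizes, is then almost the
    Lagrangian of [HH], because [m] is asymptotically at least that Lagrangian
    times [n^r] ([max_edges_ge]); weak weight stability puts [G] at small
    weighted distance from [HH], and [edit_le_weighted_dist] turns this into a
    small edit distance for the endpoint.

    Nearness is now transported back to [E].  One replacement changes only
    [O(n^(r-1))] edges, so the predecessor of a near graph is at distance at most
    [eps n^r], within reach of local stability; as it still has more than
    [m - beta n^r] edges, local stability improves this bound to [eps / 2 * n^r],
    so the predecessor is near too.  The lemma [symmetrization] packages this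
    induction.

    All blowups are handled as pullbacks along maps of vertex sets, and both
    quantitative comparisons between weighted and unweighted graphs come from a
    random map with independent values: the expected number of edges of the
    pullback is computed exactly in [mean_card_pullback], and some map does at
    least as well as the average. *)

Set Implicit Arguments.
Unset Strict Implicit.
Unset Printing Implicit Defensive.

Import Order.TTheory GRing.Theory Num.Theory.

Local Open Scope ring_scope.

(** * Blowups as pullbacks *)

(** The blowup of [E] whose vertex classes are the fibres of [s]; empty fibres
    amount to deleted vertices.  The cardinality condition says that [s] is
    injective on [e]. *)
Definition pullback (T U : finType) (s : T -> U) (E : {set {set U}}) :
  {set {set T}} := [set e | (s @: (e : {set T}) \in E) && (#|s @: e| == #|e|)].

Lemma in_pullback (T U : finType) (s : T -> U) (E : {set {set U}}) e :
  (e \in pullback s E) = (s @: e \in E) && (#|s @: e| == #|e|).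
Proof. by rewrite inE. Qed.

Lemma pullback_comp (T U V : finType) (s : T -> U) (t : U -> V) E :
  pullback s (pullback t E) = pullback (t \o s) E.
Proof.
apply/setP => e; rewrite !in_pullback -imset_comp -andbA; congr (_ && _).
apply/andP/eqP => [[/eqP -> /eqP ->]//|].
rewrite imset_comp => cardE.
have le1 := leq_imset_card t (s @: e); have le2 := leq_imset_card s e.
by split; rewrite eqn_leq ?le1 ?le2 -?cardE // cardE.
Qed.

Lemma eq_pullback (T U : finType) (s t : T -> U) E :
  s =1 t -> pullback s E = pullback t E.
Proof. by move=> st; apply/setP => e; rewrite !in_pullback (eq_imset _ st). Qed.

Lemma pullback_id (T : finType) (E : {set {set T}}) : pullback id E = E.
Proof. by apply/setP => e; rewrite in_pullback imset_id eqxx andbT. Qed.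

Lemma pullback_symdiff (T U : finType) (s : T -> U) (D E : {set {set U}}) :
  symdiff (pullback s D) (pullback s E) = pullback s (symdiff D E).
Proof.
apply/setP => e; rewrite /symdiff !inE.
by case: (_ \in D) (_ \in E) (_ == _) => [] [] [].
Qed.

Lemma uniform_pullback r (T U : finType) (s : T -> U) E :
  uniform r E -> uniform r (pullback s E).
Proof. by move=> unifE e; rewrite in_pullback => /andP[/unifE <- /eqP]. Qed.

Lemma image_edges_pullback (T U : finType) (f : T -> U) (g : U -> T) E :
  cancel f g -> cancel g f -> image_edges f E = pullback g E.
Proof.
move=> fK gK; apply/setP => e; rewrite in_pullback.
rewrite (card_imset _ (can_inj gK)) eqxx andbT.
apply/imsetP/idP => [[e' e'E ->]|gE].
  by rewrite -imset_comp (eq_imset _ (_ : _ =1 id)) ?imset_id.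
by exists (g @: e) => //; rewrite -imset_comp (eq_imset _ (_ : _ =1 id)) ?imset_id.
Qed.

Lemma delete_pullback (T : finType) (v : T) (E : {set {set T}}) :
  delete v E = pullback val E.
Proof.
by apply/setP => e; rewrite in_pullback inE (card_imset _ val_inj) eqxx andbT.
Qed.

Definition collapse (T X : finType) (v : T) (z : T + X) : T :=
  if z is inl x then x else v.

Lemma in_clone_set (T X : finType) (v : T) (w : T + X) :
  (w \in clone_set X v) = (collapse v w == v).
Proof.
rewrite in_setU1; case: w => [x|x] /=.
  rewrite orbC; case: imsetP => [[]//|_] /=.
  by apply/eqP/eqP => [[]|->].
by rewrite eqxx imset_f.
Qed.

Lemma clone_pullback (T X : finType) (v : T) (E : {set {set T}}) :
  clone X v E = pullback (@collapse T X v) E.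
Proof.
have colK (A : {set T}) : collapse v @: (@inl T X @: A) = A.
  by rewrite -imset_comp (eq_imset _ (_ : _ =1 id)) ?imset_id.
have inl_inj : injective (@inl T X) by move=> ? ? [].
apply/setP => e; rewrite in_pullback.
apply/idP/andP => [|[cE /imset_injP cinj]].
  case/setUP.
    case/imsetP => e'; rewrite inE => /andP[e'E _] ->.
    by rewrite colK e'E card_imset.
  case/imset2P => w I; rewrite in_clone_set inE => /eqP wv /andP[vI vIE] ->.
  rewrite imsetU1 wv colK vIE; split=> //.
  rewrite cardsU1 vI cardsU1 card_imset //.
  suff -> : w \notin @inl T X @: I by [].
  by apply/imsetP => -[x xI wx]; move: wv vI; rewrite wx /= => <-; rewrite xI.
apply/setUP; case: (boolP (v \in collapse v @: e)) => [vc|vc]; [right|left].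
  have /imsetP[w we wv] := vc.
  have eE : e = w |: @inl T X @: ((collapse v @: e) :\ v).
    apply/setP => z; apply/idP/setU1P => [ze|[->//|]].
      have [->|zw] := eqVneq z w; [by left|right].
      have zv : collapse v z != v.
        by apply: contra zw => /eqP zv; apply/eqP; apply: cinj => //; rewrite zv.
      case: z ze zw zv => [z|z] ze zw zv /=; last by rewrite /= eqxx in zv.
      by apply: imset_f; rewrite !inE zv /=; apply/imsetP; exists (inl z).
    case/imsetP => x; rewrite !inE => /andP[xv /imsetP[[y|y] ye xy]] ->.
      by rewrite xy.
    by rewrite xy eqxx in xv.
  rewrite {1}eE; apply: imset2_f; first by rewrite in_clone_set -wv.
  by rewrite inE setD11 /= finset.setD1K.
have eE : e = @inl T X @: (collapse v @: e).
  apply/setP => z; apply/idP/imsetP => [ze|[x /imsetP[[y|y] ye ->] ->//]].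
    case: z ze => z ze; last by case/negP: vc; apply/imsetP; exists (inr z).
    by exists z => //; apply/imsetP; exists (inl z).
  by case/negP: vc; apply/imsetP; exists (inr y).
by rewrite {1}eE; apply: imset_f; rewrite inE cE.
Qed.

Lemma isomorphic_refl (T : finType) (E : {set {set T}}) : isomorphic E E.
Proof.
exists id; first by exists id.
by rewrite (@image_edges_pullback _ _ _ id) ?pullback_id.
Qed.

(** Every pullback is a chain of clonings and deletions, up to relabelling, so
    a clonable family is closed under pullbacks. *)
Section Clonable.
Variables (FF : hypergraph_family) (FF_clonable : clonable FF).

Lemma clonable_collapse (U X : finType) (v : U) E :
  FF E -> FF (pullback (@collapse U X v) E).
Proof.
move=> FE; rewrite -clone_pullback; apply: (FF_clonable FE).
exists _, (clone X v E); split; last exact: isomorphic_refl.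
exact/clone_delete_clone/clone_delete_refl.
Qed.

Lemma clonable_val (U : finType) (v : U) (E : {set {set U}}) :
  FF E -> FF (pullback (val : {x | x != v} -> U) E).
Proof.
move=> FE; rewrite -delete_pullback; apply: (FF_clonable FE).
exists _, (delete v E); split; last exact: isomorphic_refl.
exact/clone_delete_delete/clone_delete_refl.
Qed.

Lemma clonable_bij (T U : finType) (g : T -> U) E :
  bijective g -> FF E -> FF (pullback g E).
Proof.
move=> [f gK fK] FE; apply: (FF_clonable FE).
exists _, E; split; first exact: clone_delete_refl.
by exists f; [exists g | rewrite (image_edges_pullback _ fK gK)].
Qed.

(** The vertices outside the image of [g] are deleted one at a time. *)
Lemma clonable_inj (T U : finType) (g : T -> U) E :
  injective g -> FF E -> FF (pullback g E).
Proof.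
have [k] := ubnP #|U|; elim: k => // k IHk in U g E *.
move=> leUk ginj FE.
have [/inj_card_bij gbij|ltTU] := leqP #|U| #|T|; first exact/clonable_bij/FE/gbij.
have [v vg] : exists v, v \notin codom g.
  apply/existsP; rewrite -negb_forall; apply/negP => /forallP gsurj.
  move: ltTU; rewrite -(card_codom ginj) ltnNge => /negP; apply.
  by apply/subset_leq_card/fintype.subsetP => v _.
have gv x : g x != v by apply: contra vg => /eqP <-; exact: codom_f.
pose g' x : {y | y != v} := exist _ (g x) (gv x).
rewrite (_ : pullback g E = pullback g' (pullback (val : {x | x != v} -> U) E)).
  apply: IHk; last exact: clonable_val.
    rewrite -ltnS; apply: leq_trans leUk; rewrite !ltnS card_sig.
    rewrite [X in (_ < X)%N](cardD1 v) inE add1n ltnS.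
    by apply/subset_leq_card/fintype.subsetP => y; rewrite !inE andbT.
  by move=> x y /(congr1 val) /ginj.
by rewrite pullback_comp; apply: eq_pullback.
Qed.

Definition extend_by (U X : finType) (t : X -> U) (z : U + X) : U :=
  match z with inl x => x | inr i => t i end.

(** One new vertex at a time: the last one is a clone of the old vertex
    [t ord_max], and [g] only relabels [U + 'I_k.+1] as [(U + 'I_k) + unit]. *)
Lemma clonable_extend (U : finType) k (t : 'I_k -> U) (E : {set {set U}}) :
  FF E -> FF (pullback (extend_by t) E).
Proof.
move=> FE; elim: k t => [|k IHk] t.
  by apply: clonable_bij FE; exists inl => [[x|[]]|x].
pose w : U + 'I_k := inl (t ord_max).
pose g (z : U + 'I_k.+1) : (U + 'I_k) + unit := match z with
  | inl x => inl (inl x)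
  | inr i => if unlift ord_max i is Some j then inl (inr j) else inr tt end.
have ginj : injective g.
  move=> [x|i] [y|j] //=; rewrite /g; first by case=> ->.
  - by case: unliftP.
  - by case: unliftP.
  - by case: unliftP => [i' ->|->]; case: unliftP => [j' ->|->] // [->].
rewrite (_ : pullback _ E = pullback g (pullback (@collapse _ unit w)
            (pullback (extend_by (t \o lift ord_max)) E))).
  by apply: clonable_inj ginj _; apply: clonable_collapse; apply: IHk.
rewrite !pullback_comp; apply: eq_pullback => -[x|i] //=.
by case: unliftP => [j ->|->].
Qed.

(** An arbitrary [s] is reached by adding all clones at once to [U] and then
    deleting the original vertices, so that [s] need not be surjective. *)
Lemma clonable_pullback (T U : finType) (s : T -> U) (E : {set {set U}}) :
  FF E -> FF (pullback s E).
Proof.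
move=> FE; pose g x : U + 'I_#|T| := inr (enum_rank x).
rewrite (_ : pullback s E = pullback g (pullback (extend_by (s \o enum_val)) E)).
  apply: clonable_inj; last exact: clonable_extend.
  by move=> x y [/enum_rank_inj].
by rewrite pullback_comp; apply: eq_pullback => x; rewrite /= enum_rankK.
Qed.

End Clonable.

(** By induction on the clonings: each one shares out the weight of the cloned
    vertex among its copies, so the sums over the fibres of [p] do not change. *)
Lemma weighted_clones_pullback (R : realType) (T U : finType)
  (E : {set {set T}}) (mu : T -> R) (D : {set {set U}}) (nu : U -> R) :
  distribution_on mu -> weighted_clones E mu D nu ->
  exists p : U -> T, [/\ D = pullback p E, distribution_on nu &
    forall x, \sum_(y | p y == x) nu y = mu x].
Proof.
move=> mu_distr; elim=> {U D nu} [|U X v D mu' nu _ [p [-> _ sums]] [nu_distr nuE nuv]].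
  exists id; split=> //; first by rewrite pullback_id.
  by move=> x; rewrite (big_pred1 x).
exists (p \o @collapse U X v); split=> // [|x].
  by rewrite clone_pullback pullback_comp.
rewrite -(sums x).
rewrite (partition_big (@collapse U X v) (fun y => p y == x)) //=.
apply: eq_bigr => y pyx; have [yv|yv] := eqVneq y v.
  rewrite yv -nuv; apply: eq_bigl => w; rewrite in_clone_set.
  by case: (eqVneq (collapse v w) v) => [->|_]; rewrite ?andbF // -yv pyx.
rewrite -nuE // (big_pred1 (inl y)) // => -[z|z] /=.
  rewrite (_ : (inl z == inl y :> U + X) = (z == y)); last by apply/eqP/eqP => [[]|->].
  by case: (eqVneq z y) => [->|_]; rewrite ?andbF // pyx.
by rewrite (eq_sym v) (negPf yv) andbF.
Qed.

Lemma weighted_blowup_pullback (R : realType) (T U : finType)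
  (E : {set {set T}}) (mu : T -> R) (D : {set {set U}}) (nu : U -> R) :
  distribution_on mu -> weighted_blowup E mu D nu ->
  exists p : U -> T, [/\ D = pullback p E, forall y, 0 <= nu y &
    forall x, \sum_(y | p y == x) nu y = mu x].
Proof.
move=> mu_distr [S [D' [nu' [clones [f [[g fK gK] -> nuE]]]]]].
have [p [-> [nu01 _] sums]] := weighted_clones_pullback mu_distr clones.
exists (p \o g); split=> [|y|x].
- by rewrite (image_edges_pullback _ fK gK) pullback_comp.
- by rewrite -(gK y) nuE; case/andP: (nu01 (g y)).
- rewrite -(sums x) (reindex f); last by exists g => y _.
  by apply: eq_big => y /=; rewrite ?fK.
Qed.

(** * Counting edges *)

Lemma ffact_le_expn n r : (n ^_ r <= n ^ r)%N.
Proof.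
elim: r => [|r IHr]; first by rewrite ffactn0.
by rewrite ffactnSr expnSr leq_mul ?leq_subr.
Qed.

(** [n ^_ r >= n ^ r - r ^ 2 * n ^ (r - 1)], multiplied by [n] to avoid the
    exponent [r - 1]. *)
Lemma expn_le_ffact n r : (n ^ r * n <= n ^_ r * n + r ^ 2 * n ^ r)%N.
Proof.
elim: r => [|r IHr]; first by rewrite !expn0 ffactn0 leq_addr.
rewrite ffactnSr expnS; have FA := ffact_le_expn n r.
have le_n : (n <= n - r + r)%N by lia.
move: (n ^_ r) (n ^ r)%N (n - r)%N FA le_n IHr => F A d FA le_n IHr.
have h1 : (n * (A * n) <= n * (F * n + r ^ 2 * A))%N by rewrite leq_mul2l IHr orbT.
have h2 : (F * n * n <= F * n * (d + r))%N by rewrite leq_mul2l le_n orbT.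
have h3 : (F * (n * r) <= A * (n * r))%N by rewrite leq_mul2r FA orbT.
nia.
Qed.

Lemma card_uniform_le r (T : finType) (E : {set {set T}}) :
  uniform r E -> (#|E| <= #|T| ^ r)%N.
Proof.
move=> unifE; apply: leq_trans (ffact_le_expn _ _).
apply: (@leq_trans 'C(#|T|, r)); last by rewrite -bin_ffact leq_pmulr // fact_gt0.
rewrite -card_draws; apply/subset_leq_card/fintype.subsetP => e /unifE er.
by rewrite inE er.
Qed.

Lemma uniform_symdiff r (T : finType) (A B : {set {set T}}) :
  uniform r A -> uniform r B -> uniform r (symdiff A B).
Proof. by move=> unifA unifB e; rewrite !inE => /orP[] /andP[_] => [/unifA|/unifB]. Qed.

Lemma symdiff_triangle (T : finType) (A B C : {set T}) :
  (#|symdiff A C| <= #|symdiff A B| + #|symdiff B C|)%N.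
Proof.
rewrite -cardsUI; apply: leq_trans (leq_addr _ _).
apply/subset_leq_card/fintype.subsetP => x; rewrite !inE.
by case: (_ \in A) (_ \in B) (_ \in C) => [] [] [].
Qed.

Section Degree.
Variables (T : finType).
Implicit Types (E : {set {set T}}) (x : T).

Definition star E x : {set {set T}} := [set e in E | x \in e].
Definition nonadjacent E x y := [forall e in E, ~~ ((x \in e) && (y \in e))].

(** Removing [x] from the edges of its star leaves distinct [(r - 1)]-sets, so a
    vertex has degree at most [n ^ (r - 1)].  Multiplying by [n] also covers
    [r = 0], where the star is empty. *)
Lemma star_le r E x : uniform r E -> (#|star E x| * #|T| <= #|T| ^ r)%N.
Proof.
move=> unifE; case: r unifE => [|r] unifE.
  rewrite (_ : star E x = finset.set0) ?cards0 //; apply/setP => e; rewrite !inE.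
  by apply/negP => /andP[/unifE/eqP]; rewrite cards_eq0 => /eqP ->; rewrite inE.
rewrite expnSr leq_mul2r; apply/orP; right.
rewrite -(@card_in_imset _ _ (fun e : {set T} => e :\ x)%SET (mem (star E x))).
  apply: card_uniform_le => _ /imsetP[e /[!inE] /andP[/unifE er xe] ->].
  by move: er; rewrite (cardsD1 x) xe add1n => -[->].
move=> e1 e2; rewrite !inE => /andP[_ x1] /andP[_ x2] eq12.
by rewrite -(finset.setD1K x1) eq12 finset.setD1K.
Qed.

End Degree.

(** * Random maps between vertex sets *)

Section RandomMap.
Variables (R : realType) (T U : finType) (p : T -> U -> R).
Hypotheses (p_ge0 : forall x u, 0 <= p x u) (p_sum1 : forall x, \sum_u p x u = 1).

(** The law of a random map whose values [s x] are independent, [s x] having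
    distribution [p x]. *)
Definition map_prob (s : {ffun T -> U}) : R := \prod_x p x (s x).

Lemma map_prob_ge0 s : 0 <= map_prob s.
Proof. by apply: prodr_ge0 => x _. Qed.

Lemma map_prob_sum1 : \sum_s map_prob s = 1.
Proof. by rewrite -bigA_distr_bigA big1. Qed.

Lemma prob_prescribed k (h : 'I_k -> T) (t : 'I_k -> U) : injective h ->
  \sum_(s : {ffun T -> U} | [forall i, s (h i) == t i]) map_prob s =
  \prod_i p (h i) (t i).
Proof.
move=> hinj; pose Q x : pred U := [pred u | [forall i, (h i == x) ==> (u == t i)]].
transitivity (\sum_(s in family Q) map_prob s).
  apply: eq_bigl => s; apply/forallP/familyP => [st x|sQ i].
    by apply/forallP => i; apply/implyP => /eqP <-; exact: st.
  by have /forallP/(_ i)/implyP/(_ (eqxx _)) := sQ (h i).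
rewrite -bigA_distr_big_dep (bigID (mem (h @: [set: 'I_k]))) /= mulrC big1 ?mul1r.
  rewrite big_imset /=; last by move=> i j _ _ /hinj.
  apply: eq_big => [i|i _]; first by rewrite inE.
  apply: big_pred1 => u /=; apply/forallP/eqP => [/(_ i)|-> j].
    by rewrite eqxx => /eqP.
  by apply/implyP => /eqP/hinj ->.
move=> x xh; rewrite -(p_sum1 x); apply: eq_bigl => u; apply/forallP => i.
by apply/implyP => /eqP hx; case/negP: xh; rewrite -hx imset_f.
Qed.

(** An edge lying injectively over [f] is the same as a choice of one vertex in
    each of the fibres over [f].  Indexing by ['I_#|f|] rather than by [f] makes
    these choices finite functions, over which products of sums expand. *)
Lemma card_fibre_edges (s : T -> U) (f : {set U}) :
  #|[set e : {set T} | (s @: e == f) && (#|s @: e| == #|e|)]| =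
  #|[set h : {ffun 'I_#|f| -> T} | [forall i, s (h i) == enum_val i]]|.
Proof.
rewrite -(card_in_imset (f := fun h : {ffun 'I_#|f| -> T} => h @: [set: 'I_#|f|])).
  apply: eq_card => e; rewrite inE.
  apply/andP/imsetP => [[/eqP sef /eqP card_se]|[h]]; last first.
    rewrite inE => /forallP hs ->.
    have sh i : s (h i) = enum_val i by apply/eqP/hs.
    have hinj : injective h.
      by move=> i j hij; apply: enum_val_inj; rewrite -!sh hij.
    have -> : s @: (h @: [set: 'I_#|f|]) = f.
      rewrite -imset_comp; apply/setP => u; apply/imsetP/idP => [[i _ ->] /=|uf].
        by rewrite sh enum_valP.
      by exists (enum_rank_in uf u) => //; rewrite [RHS]sh enum_rankK_in.
    by rewrite card_imset // cardsT card_ord.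
  have ex (i : 'I_#|f|) : exists x, (x \in e) && (s x == enum_val i).
    have : enum_val i \in s @: e by rewrite sef; exact: enum_valP.
    case/imsetP => x xe sx.
    by exists x; rewrite xe sx eqxx.
  have [h hP] := fin_all_exists ex.
  exists [ffun i => h i].
    by rewrite inE; apply/forallP => i; rewrite ffunE; case/andP: (hP i).
  apply/esym/eqP; rewrite eqEcard; apply/andP; split.
    by apply/fintype.subsetP => x /imsetP[i _ ->]; rewrite ffunE; case/andP: (hP i).
  rewrite card_imset ?cardsT ?card_ord -?card_se ?sef //.
  move=> i j; rewrite !ffunE => hij; apply: enum_val_inj.
  by case/andP: (hP i) => _ /eqP <-; case/andP: (hP j) => _ /eqP <-; rewrite hij.
move=> h1 h2; rewrite !inE => /forallP h1s /forallP h2s h12; apply/ffunP => i.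
have /imsetP[j _ hij] : h1 i \in h2 @: [set: 'I_#|f|] by rewrite -h12 imset_f.
rewrite hij; congr (h2 _); apply: enum_val_inj.
by rewrite -(eqP (h1s i)) -(eqP (h2s j)) hij.
Qed.

Lemma card_pullback (s : T -> U) (D : {set {set U}}) :
  #|pullback s D| = (\sum_(f in D)
    #|[set h : {ffun 'I_#|f| -> T} | [forall i, s (h i) == enum_val i]]|)%N.
Proof.
rewrite -sum1_card (partition_big (fun e : {set T} => s @: e) (mem D)) /=; last first.
  by move=> e; rewrite in_pullback => /andP[].
apply: eq_bigr => f fD; rewrite -card_fibre_edges -sum1_card.
apply: eq_bigl => e; rewrite in_pullback inE.
by case: (eqVneq (s @: e) f) => [->|]; rewrite ?andbF // fD andbT.
Qed.

(** By linearity of expectation: the random map sends the vertices [h i] to the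
    successive elements of [f] with probability [\prod_i p (h i) (enum_val i)]
    if [h] is injective, by independence, and never otherwise, because a vertex
    has a single image. *)
Lemma mean_card_pullback (D : {set {set U}}) :
  \sum_s map_prob s * #|pullback s D|%:R =
  \sum_(f in D) \sum_(h : {ffun 'I_#|f| -> T} | injectiveb h)
     \prod_i p (h i) (enum_val i).
Proof.
transitivity (\sum_(s : {ffun T -> U}) \sum_(f in D) \sum_(h : {ffun 'I_#|f| -> T})
   map_prob s * [forall i, s (h i) == enum_val i]%:R).
  apply: eq_bigr => s _; rewrite card_pullback natr_sum mulr_sumr.
  apply: eq_bigr => f _; rewrite -mulr_sumr; congr (_ * _).
  rewrite -natr_sum -sum1_card; congr _%:R.
  by rewrite big_mkcond /=; apply: eq_bigr => h _; rewrite inE; case: ifP.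
rewrite exchange_big /=; apply: eq_bigr => f _.
rewrite exchange_big [RHS]big_mkcond /=; apply: eq_bigr => h _.
transitivity (\sum_(s : {ffun T -> U} | [forall i, s (h i) == enum_val i]) map_prob s).
  rewrite [RHS]big_mkcond /=; apply: eq_bigr => s _.
  by case: ifP => _; rewrite ?mulr1 ?mulr0.
case: ifP => [/injectiveP|/injectiveP hinj]; first exact: prob_prescribed.
rewrite big_pred0 // => s; apply/negP => /forallP sh; apply: hinj => i j hij.
by apply: enum_val_inj; rewrite -(eqP (sh i)) -(eqP (sh j)) hij.
Qed.

(** Allowing non-injective choices completes the sum to a product of sums. *)
Lemma mean_card_pullback_le (D : {set {set U}}) :
  \sum_s map_prob s * #|pullback s D|%:R <=
  \sum_(f in D) \prod_(u in f) \sum_x p x u.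
Proof.
rewrite mean_card_pullback; apply: ler_sum => f _.
rewrite (big_enum_val (A := mem f) (fun u => \sum_x p x u)) /=.
rewrite (bigA_distr_bigA (fun i x => p x (enum_val i))) /=.
rewrite [leRHS](bigID (fun h : {ffun 'I_#|f| -> T} => injectiveb h)) /= lerDl.
by apply: sumr_ge0 => h _; apply: prodr_ge0.
Qed.

Lemma exists_le_mean (N : {ffun T -> U} -> R) :
  exists s, 0 < map_prob s /\ N s <= \sum_t map_prob t * N t.
Proof.
set B := \sum_t map_prob t * N t; apply: contrapT => no.
have gtB s : 0 < map_prob s -> B < N s.
  by move=> s_gt0; rewrite ltNge; apply/negP => NsB; apply: no; exists s.
have term_ge0 s : 0 <= map_prob s * (N s - B).
  have := map_prob_ge0 s; rewrite le_eqVlt => /orP[/eqP <-|s_gt0].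
    by rewrite mul0r.
  by rewrite mulr_ge0 ?(ltW s_gt0) // subr_ge0 ltW ?gtB.
have sum0 : \sum_s map_prob s * (N s - B) = 0.
  under eq_bigr do rewrite mulrBr.
  by rewrite big_split /= sumrN -mulr_suml map_prob_sum1 mul1r subrr.
have := map_prob_sum1; rewrite big1 => [/esym/eqP|s _]; first by rewrite oner_eq0.
have /eqP : map_prob s * (N s - B) = 0.
  by apply: (psumr_eq0P _ sum0).
rewrite mulf_eq0 => /orP[/eqP //|]; rewrite subr_eq0 => /eqP NB.
apply/eqP; rewrite eq_le map_prob_ge0 andbT leNgt.
by apply/negP => /gtB; rewrite NB ltxx.
Qed.

End RandomMap.

Definition class_size (T S : finType) (c : T -> S) (v : S) : nat :=
  #|[set x | c x == v]|.

(** The deterministic case of the bound on the mean, with all mass at [c]. *)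
Lemma card_pullback_le_density (R : realType) (T U : finType) (c : T -> U)
  (E : {set {set U}}) :
  #|pullback c E|%:R <= \sum_(f in E) \prod_(u in f) (class_size c u)%:R :> R.
Proof.
pose p x u : R := (c x == u)%:R.
have p_ge0 x u : 0 <= p x u by rewrite ler0n.
have p1 x : \sum_u p x u = 1.
  by rewrite (bigD1 (c x)) //= big1 ?addr0 /p ?eqxx // => u; rewrite eq_sym => /negPf ->.
have := mean_card_pullback_le p_ge0 p1 E.
rewrite (bigD1 [ffun x => c x]) //= {1}/map_prob big1; last first.
  by move=> x _; rewrite /p ffunE eqxx.
rewrite mul1r (@eq_pullback _ _ [ffun x => c x] c) => [le|x]; last by rewrite ffunE.
apply: le_trans (le_trans _ le) _.
  rewrite lerDl; apply: sumr_ge0 => s _; rewrite mulr_ge0 //.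
  by rewrite map_prob_ge0.
apply: ler_sum => f _; rewrite le_eqVlt; apply/orP; left; apply/eqP.
apply: eq_bigr => u _; rewrite /class_size -sum1_card natr_sum [RHS]big_mkcond /=.
by apply: eq_bigr => x _; rewrite inE /p; case: ifP.
Qed.

(** Some map does at least as well as a random one with independent values of
    law [nu]; the falling factorial counts the injective choices of [r] vertices
    and replaces the power that one would get with repetitions. *)
Lemma card_pullback_iid (R : realType) r (T U : finType) (D : {set {set U}})
  (nu : U -> R) : distribution_on nu -> uniform r D ->
  exists s : T -> U, (#|T| ^_ r)%:R * density D nu <= #|pullback s D|%:R.
Proof.
move=> [nu01 nu1] unifD.
have nu_ge0 (x : T) u : 0 <= nu u by case/andP: (nu01 u).
have [s [_ sP]] := exists_le_mean nu_ge0 (fun=> nu1)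
  (fun s : {ffun T -> U} => - #|pullback s D|%:R).
exists s; rewrite -lerN2; apply: le_trans sP _.
under eq_bigr do rewrite mulrN.
rewrite sumrN lerN2 (mean_card_pullback (fun=> nu1)) le_eqVlt.
apply/orP; left; apply/eqP; rewrite mulr_sumr; apply: eq_bigr => f /unifD fr.
rewrite sumr_const (big_enum_val (A := mem f) nu) mulr_natl; congr (_ *+ _).
rewrite -fr -[X in (_ ^_ X)%N]card_ord -card_inj_ffuns.
by apply: eq_card => h; rewrite inE.
Qed.

(** * Edit distance and extremal numbers *)

Lemma edit_dist_le (R : realType) (HH : hypergraph_family) (T : finType)
  (E H : {set {set T}}) :
  HH T H -> (edit_dist R HH E <= #|symdiff E H|%:R%:E)%E.
Proof.
move=> HHH; rewrite /edit_dist.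
apply: (@bigmin_le_cond _ _ _ _ H (fun E' => `[< HH T E' >])
  (fun E' => #|symdiff E E'|%:R%:E)).
exact/asboolP.
Qed.

Lemma edit_dist_attained (R : realType) (HH : hypergraph_family) (T : finType)
  (E : {set {set T}}) : (edit_dist R HH E < +oo)%E ->
  exists2 H, HH T H & edit_dist R HH E = #|symdiff E H|%:R%:E.
Proof.
move=> fin; have [[H0 HH0]|no] := pselect (exists H, HH T H); last first.
  by move: fin; rewrite /edit_dist big_pred0 ?ltxx // => H; apply/asboolP => HH_;
  apply: no; exists H.
rewrite /edit_dist (@bigmin_eq_arg _ _ _ _ H0 (fun E' => `[< HH T E' >])).
- by case: Order.TotalTheory.arg_minP => [|H /asboolP HHH _]; [exact/asboolP | exists H].
- exact/asboolP.
- by move=> H _; exact: leey.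
Qed.

Lemma le_max_edges (HH : hypergraph_family) (HH_clonable : clonable HH)
  (T : finType) (E : {set {set T}}) : HH T E -> (#|E| <= max_edges HH #|T|)%N.
Proof.
move=> HE; have HE' := clonable_pullback HH_clonable (@enum_val T T) HE.
have <- : #|pullback (@enum_val T T) E| = #|E|.
  rewrite -(@image_edges_pullback _ _ enum_rank) ?card_imset //.
  - exact/imset_inj/enum_rank_inj.
  - exact: enum_rankK.
  - exact: enum_valK.
rewrite /max_edges.
by apply: (@leq_bigmax_cond _ _ (fun A : {set {set _}} => #|A|)); exact/asboolP.
Qed.

Lemma density_ge0 (R : realType) (T : finType) (E : {set {set T}}) (mu : T -> R) :
  (forall x, 0 <= mu x) -> 0 <= density E mu.
Proof. by move=> mu_ge0; apply: sumr_ge0 => e _; apply: prodr_ge0. Qed.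

(** The convention [sup A = 0] for a set without supremum is harmless here: a
    set whose [sup] is positive does have a supremum. *)
Lemma sup_approx (R : realType) (A : set R) (d : R) : 0 < d ->
  d < sup A -> exists2 x, A x & sup A - d < x.
Proof.
move=> d_gt0 dsup; apply: sup_adherent => //.
by apply: contrapT => /sup_out sup0; move: dsup; rewrite sup0 ltNge ltW.
Qed.

Lemma family_lagrangian_approx (R : realType) (HH : hypergraph_family) (d : R) :
  0 < d -> d < family_lagrangian R HH ->
  exists (T : finType) (E : {set {set T}}) (nu : T -> R),
    [/\ HH T E, distribution_on nu & family_lagrangian R HH - d < density E nu].
Proof.
move=> d_gt0 dlt.
have d2 : 0 < d / 2 by lra.
have [|l [T [E [HE ->]]] ltE] := @sup_approx R [set l | exists (T : finType)
    (E : {set {set T}}), HH T E /\ l = lagrangian R E]%classic _ d2.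
  by apply: lt_trans dlt; lra.
have [|_ [nu nu_distr <-] ltnu] := @sup_approx R
    [set density E mu | mu in @distribution_on R T]%classic _ d2.
  by move: ltE dlt; rewrite /family_lagrangian /lagrangian => ltE dlt; lra.
exists T, E, nu; split=> //.
by move: ltE ltnu; rewrite /family_lagrangian /lagrangian => ltE ltnu; lra.
Qed.

(** The Lagrangian of [HH] is an asymptotic lower bound for its extremal
    numbers: blow up a nearly optimal weighted member along a random map. *)
Lemma max_edges_ge (R : realType) r (HH : hypergraph_family)
  (HH_rgraphs : rgraph_family r HH) (HH_clonable : clonable HH) (d : R) : 0 < d ->
  exists n0, forall n, (n0 <= n)%N ->
    (family_lagrangian R HH - d) * n%:R ^+ r <= (max_edges HH n)%:R.
Proof.
move=> d_gt0; have [small|big] := leP (family_lagrangian R HH) (d / 2).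
  exists 0%N => n _; apply: le_trans (ler0n _ _).
  by rewrite mulr_le0_ge0 ?exprn_ge0 ?subr_le0 //; lra.
have [|T [E [nu [HE nu_distr dens]]]] := family_lagrangian_approx _ big; first by lra.
set q := density E nu in dens.
have q_ge0 : 0 <= q by apply: density_ge0 => x; case: nu_distr => /(_ x)/andP[].
(* Beyond [B] the relative loss [r ^ 2 / n] of the falling factorial costs at
   most [d / 2]. *)
pose B : R := 2 * q * r%:R ^+ 2 / d.
have B_ge0 : 0 <= B.
  by rewrite divr_ge0 ?(ltW d_gt0) // mulr_ge0 ?exprn_ge0 // mulr_ge0.
exists (Num.bound B).+1 => n nB.
have n_gt0 : (0 < n)%N by apply: leq_trans nB.
have Bn : B < n%:R.
  by apply: lt_trans (archi_boundP B_ge0) _; rewrite ltr_nat.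
have [s sP] := @card_pullback_iid R r 'I_n T E nu nu_distr (HH_rgraphs.1 _ _ HE).
have := le_max_edges HH_clonable (clonable_pullback HH_clonable s HE).
rewrite card_ord in sP *; rewrite -(ler_nat R) => /(le_trans sP); apply: le_trans.
have := expn_le_ffact n r; rewrite -(ler_nat R) natrD !natrM !natrX => ffact_ge.
rewrite -/q; set N : R := n%:R in ffact_ge Bn *.
have N_gt0 : 0 < N by rewrite ltr0n.
set A := N ^+ r in ffact_ge *; set F : R := (n ^_ r)%:R in ffact_ge *.
have A_ge0 : 0 <= A by rewrite exprn_ge0 // ltW.
have qB : 2 * q * r%:R ^+ 2 <= d * N.
  by move: (ltW Bn); rewrite /B ler_pdivrMr // [N * d]mulrC.
rewrite -(ler_pM2r N_gt0).
have h1 : q * (A * N) <= q * (F * N + r%:R ^+ 2 * A) by rewrite ler_wpM2l.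
have h2 : 2 * q * r%:R ^+ 2 * A <= d * N * A by rewrite ler_wpM2r.
have h3 : (family_lagrangian R HH - d / 2) * (A * N) <= q * (A * N).
  by rewrite ler_wpM2r ?(ltW dens) // mulr_ge0 // ltW.
lra.
Qed.

(** * From weighted distance to edit distance *)

Section Rounding.
Variables (R : realType) (r : nat) (T S : finType) (c : T -> S).
Hypothesis c_surj : forall v, exists x, c x = v.

Definition class_weight (v : S) : R := (class_size c v)%:R / #|T|%:R.

Lemma class_size_gt0 v : (0 < class_size c v)%N.
Proof. by have [x <-] := c_surj v; apply/card_gt0P; exists x; rewrite inE. Qed.

Lemma sum_class_size : (\sum_v class_size c v = #|T|)%N.
Proof.
rewrite -sum1_card (partition_big c xpredT) //=; apply: eq_bigr => v _.
by rewrite /class_size -sum1_card; apply: eq_bigl => x; rewrite inE.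
Qed.

Hypothesis T_gt0 : (0 < #|T|)%N.

Lemma class_weight_distribution : distribution_on class_weight.
Proof.
have T_gt0' : 0 < #|T|%:R :> R by rewrite ltr0n.
split=> [v|].
  rewrite divr_ge0 //= ler_pdivrMr // mul1r ler_nat -sum_class_size.
  by rewrite (bigD1 v) //= leq_addr.
by rewrite -mulr_suml -natr_sum sum_class_size divff // gt_eqF.
Qed.

Lemma card_pullback_class_weight (G : {set {set S}}) : uniform r G ->
  #|pullback c G|%:R <= density G class_weight * #|T|%:R ^+ r.
Proof.
move=> unifG; apply: le_trans (card_pullback_le_density _ _ _) _.
rewrite mulr_suml; apply: ler_sum => f /unifG fr.
rewrite big_split /= prodr_const fr exprVn mulfVK // expf_eq0 pnatr_eq0.
by rewrite (gtn_eqF T_gt0) andbF.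
Qed.

Variables (FF HH : hypergraph_family).
Hypotheses (FF_rgraphs : rgraph_family r FF) (HH_rgraphs : rgraph_family r HH).
Hypothesis HH_clonable : clonable HH.

(** A weighted comparison of [G] with some [H0] of [HH] takes place on a common
    blowup [U] of both.  Sending each vertex [x] to a random point of [U] above
    [c x], chosen proportionally to the weight [m], realizes [pullback c G] as a
    pullback of the blowup of [G], and the same map pulls the blowup of [H0] back
    to a member of [HH] on [T].  The expected symmetric difference is at most
    [n ^ r] times the weighted one, so no rounding of weights is involved. *)
Lemma edit_le_weighted_dist (G : {set {set S}}) (e : R) : FF G ->
  (family_weighted_dist HH G class_weight < e%:E)%E ->
  exists2 H, HH H & #|symdiff (pullback c G) H|%:R <= e * #|T|%:R ^+ r.
Proof.
move=> FG /ereal_inf_lt[_ [V [H0 [nu [HH0 nu_distr ->]]]]].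
move=> /ereal_inf_lt[_ [U [D1 [D2 [m [blow1 blow2 ->]]]]]]; rewrite lte_fin => lt_e.
have [p1 [D1E m_ge0 p1_sum]] := weighted_blowup_pullback class_weight_distribution blow1.
have [p2 [D2E _ _]] := weighted_blowup_pullback nu_distr blow2.
have T_neq0 : #|T|%:R != 0 :> R by rewrite pnatr_eq0 -lt0n.
have size_neq0 v : (class_size c v)%:R != 0 :> R by rewrite pnatr_eq0 -lt0n class_size_gt0.
pose p (x : T) (u : U) : R :=
  if p1 u == c x then #|T|%:R * m u / (class_size c (c x))%:R else 0.
have p_ge0 x u : 0 <= p x u.
  by rewrite /p; case: ifP => // _; rewrite divr_ge0 // mulr_ge0.
have p_sum1 x : \sum_u p x u = 1.
  rewrite -big_mkcond /= -mulr_suml -mulr_sumr p1_sum /class_weight.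
  by rewrite mulrC [_ * (_ / _)]mulrC divfK // mulVf.
have [s [s_gt0 sP]] := exists_le_mean p_ge0 p_sum1
  (fun s : {ffun T -> U} => #|pullback s (symdiff D1 D2)|%:R).
have sc x : p1 (s x) = c x.
  apply/eqP; apply: contraTT s_gt0 => ne; rewrite /map_prob (bigD1 x) //=.
  by rewrite {1}/p (negPf ne) mul0r ltxx.
exists (pullback s D2).
  by rewrite D2E; do 2! apply: clonable_pullback => //.
have -> : pullback c G = pullback s D1.
  by rewrite D1E pullback_comp; apply: eq_pullback => x; rewrite /= sc.
rewrite pullback_symdiff; apply: (le_trans sP).
apply: le_trans (mean_card_pullback_le p_ge0 p_sum1 _) _.
apply: le_trans (_ : density (symdiff D1 D2) m * #|T|%:R ^+ r <= _); last first.
  by rewrite ler_wpM2r ?exprn_ge0 // ltW.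
have unifD : uniform r (symdiff D1 D2).
  rewrite D1E D2E; apply: uniform_symdiff; apply: uniform_pullback.
    exact: FF_rgraphs.1 FG.
  exact: HH_rgraphs.1 HH0.
(* The masses that the vertices of [T] put on [u] add up to [n * m u]. *)
rewrite mulr_suml; apply: ler_sum => f /unifD fr.
rewrite le_eqVlt; apply/orP; left; apply/eqP.
rewrite -[in RHS]fr -prodr_const -big_split /=; apply: eq_bigr => u _.
transitivity (\sum_(x | c x == p1 u) (#|T|%:R * m u / (class_size c (p1 u))%:R)).
  rewrite [RHS]big_mkcond /=; apply: eq_bigr => x _; rewrite /p eq_sym.
  by case: eqP => [->|].
rewrite sumr_const (_ : #|_| = class_size c (p1 u)); last first.
  by apply: eq_card => x; rewrite inE.
by rewrite -[LHS]mulr_natr divfK // mulrC.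
Qed.

End Rounding.

(** * Zykov symmetrization *)

(** The number of ordered pairs of vertices in a common class. *)
Definition twin_pairs (T S : finType) (c : T -> S) : nat :=
  (\sum_v class_size c v ^ 2)%N.

Section Move.
Variables (T S : finType) (c : {ffun T -> S}) (x y : T).

Definition move_to : {ffun T -> S} := [ffun z => if z == x then c y else c z].

Hypothesis cxy : c x != c y.

Let xy : x != y. Proof. by apply: contra cxy => /eqP ->. Qed.

Let move_off z : z != x -> move_to z = c z.
Proof. by move=> /negPf zx; rewrite ffunE zx. Qed.

Lemma twin_pairs_move_to :
  (twin_pairs move_to + 2 * class_size c (c x) = twin_pairs c + 2 * class_size c (c y) + 2)%N.
Proof.
have off v : v != c x -> v != c y -> class_size move_to v = class_size c v.
  move=> vx vy; apply: eq_card => z; rewrite !inE ffunE; case: (eqVneq z x) => // ->.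
  by rewrite ![_ == v]eq_sym (negPf vx) (negPf vy).
have at_x : (class_size move_to (c x)).+1 = class_size c (c x).
  rewrite /class_size [RHS](cardsD1 x) inE eqxx add1n; congr _.+1; apply: eq_card => z.
  rewrite !inE ffunE; case: (eqVneq z x) => [->|_] //=.
  by rewrite eq_sym (negPf cxy).
have at_y : class_size move_to (c y) = (class_size c (c y)).+1.
  rewrite /class_size [LHS](cardsD1 x) !inE ffunE !eqxx add1n; congr _.+1; apply: eq_card => z.
  rewrite !inE ffunE; case: (eqVneq z x) => [->|_] //=.
  by rewrite (negPf cxy).
have split_sum (d : T -> S) : twin_pairs d =
    (class_size d (c x) ^ 2 + (class_size d (c y) ^ 2 +
    \sum_(v | (v != c x) && (v != c y)) class_size d v ^ 2))%N.
  by rewrite /twin_pairs (bigD1 (c x)) //= (bigD1 (c y)) 1?eq_sym.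
have rest : (\sum_(v | (v != c x) && (v != c y)) class_size move_to v ^ 2 =
             \sum_(v | (v != c x) && (v != c y)) class_size c v ^ 2)%N.
  by apply: eq_bigr => v /andP[vx vy]; rewrite off.
rewrite !split_sum rest at_y -at_x -!mulnn.
move: (class_size _ _) (class_size _ _) (\sum_(_ | _) _)%N => a b S0; lia.
Qed.

Variable F : {set {set S}}.

Lemma move_to_edges_off (e : {set T}) : x \notin e ->
  (e \in pullback move_to F) = (e \in pullback c F).
Proof.
move=> xe; rewrite !in_pullback (@eq_in_imset _ _ move_to c) // => z ze.
by apply: move_off; apply: contraNneq xe => <-.
Qed.

Hypothesis nonadj : nonadjacent (pullback c F) x y.

(** After the move [x] is a twin of [y]; exchanging the two maps the edges
    through [y] before to the edges through [x] after.  Nonadjacency ensures that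
    no edge through [y] is lost for containing [x]. *)
Lemma star_move_to :
  star (pullback move_to F) x = [set tperm x y @: (e : {set T}) | e in star (pullback c F) y].
Proof.
have tK (e : {set T}) : tperm x y @: (tperm x y @: e) = e.
  by rewrite -imset_comp (eq_imset _ (_ : _ =1 id)) ?imset_id // => z; apply: tpermK.
have tcard (e : {set T}) : #|tperm x y @: e| = #|e|.
  exact/card_imset/perm_inj.
apply/setP => e; rewrite [LHS]inE; apply/andP/imsetP => [[eQ xe]|[e' ]].
  have ye : y \notin e.
    apply/negP => ye; move: eQ; rewrite in_pullback => /andP[_ /imset_injP inj].
    by move: xy; rewrite (inj x y xe ye) ?eqxx // (move_off (z := y)) 1?eq_sym // ffunE eqxx.
  exists (tperm x y @: e); rewrite ?tK // inE; apply/andP; split; last first.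
    by apply/imsetP; exists x; rewrite ?tpermL.
  move: eQ; rewrite !in_pullback tcard -imset_comp.
  rewrite (@eq_in_imset _ _ (c \o tperm x y) move_to) // => z ze; rewrite /= ffunE.
  case: tpermP => [->|zy|/eqP/negPf -> //]; first by rewrite eqxx.
  by rewrite -zy ze in ye.
rewrite inE => /andP[eP ye'] ->; have xe' : x \notin e'.
  by have /forall_inP/(_ _ eP) := nonadj; rewrite ye' andbT.
split; last by apply/imsetP; exists y; rewrite ?tpermR.
move: eP; rewrite !in_pullback tcard -imset_comp.
rewrite (@eq_in_imset _ _ (move_to \o tperm x y) c) // => z ze; rewrite /= ffunE.
case: tpermP => [zx|->|/eqP/negPf -> //]; last by rewrite eqxx.
by rewrite -zx ze in xe'.
Qed.

Lemma card_star_move_to : #|star (pullback move_to F) x| = #|star (pullback c F) y|.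
Proof. by rewrite star_move_to card_imset //; apply/imset_inj/perm_inj. Qed.

Lemma card_move_to :
  (#|pullback move_to F| + #|star (pullback c F) x| =
   #|pullback c F| + #|star (pullback c F) y|)%N.
Proof.
have split_star (E : {set {set T}}) :
  #|E| = (#|star E x| + #|[set e in E | x \notin e]|)%N.
  rewrite -(cardsID [set e : {set T} | x \in e] E); congr (_ + _)%N; apply: eq_card => e.
    by rewrite !inE.
  by rewrite !inE andbC.
rewrite (split_star (pullback move_to F)) (split_star (pullback c F)).
rewrite card_star_move_to.
rewrite (_ : [set e in pullback move_to F | x \notin e] =
             [set e in pullback c F | x \notin e]); first lia.
apply/setP => e; rewrite [LHS]inE [RHS]inE.
by case xe : (x \in e); rewrite ?andbF // move_to_edges_off ?xe.
Qed.

Lemma symdiff_move_to :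
  (#|symdiff (pullback c F) (pullback move_to F)| <=
   #|star (pullback c F) x| + #|star (pullback c F) y|)%N.
Proof.
rewrite -card_star_move_to -cardsUI; apply: leq_trans (leq_addr _ _).
apply/subset_leq_card/fintype.subsetP => e.
rewrite /symdiff !finset.in_setU !finset.in_setD ![_ \in star _ _]inE.
case xe : (x \in e); last by rewrite move_to_edges_off ?xe //; case: (_ \in _).
by case: (_ \in _) (_ \in _) => [] [].
Qed.

End Move.

Lemma twin_pairs_le (T S : finType) (c : T -> S) :
  (twin_pairs c <= #|S| * #|T| ^ 2)%N.
Proof.
rewrite -sum_nat_const; apply: leq_sum => v _.
by rewrite leq_exp2r // max_card.
Qed.

(** Induction along a maximal symmetrization, in contrapositive form: among the
    maps [c] whose pullback has at least as many edges as [F] but fails [P],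
    consider one maximizing the number of edges and then the number of twin
    pairs.  By the second hypothesis, it has a nonadjacent pair in distinct
    classes.  Moving the vertex of smaller degree, or in case of a tie the one in
    the smaller class, increases this potential, so the moved pullback satisfies
    [P] and the first hypothesis brings [P] back.  Twin pairs are needed because
    a move between vertices of equal degree leaves the number of edges
    unchanged. *)
Lemma symmetrization (T : finType) (F : {set {set T}}) (P : {set {set T}} -> Prop) :
  (forall (c : {ffun T -> T}) x y, c x != c y -> nonadjacent (pullback c F) x y ->
     (#|F| <= #|pullback c F| <= #|pullback (move_to c x y) F|)%N ->
     P (pullback (move_to c x y) F) -> P (pullback c F)) ->
  (forall c : T -> T, (#|F| <= #|pullback c F|)%N ->
     (forall x y, c x != c y -> ~~ nonadjacent (pullback c F) x y) ->
     P (pullback c F)) ->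
  P F.
Proof.
move=> step base; apply: contrapT => notPF.
(* The factor exceeds every number of twin pairs, making [Phi] lexicographic. *)
pose Phi (c : {ffun T -> T}) :=
  (#|pullback c F| * (#|T| * #|T| ^ 2).+1 + twin_pairs c)%N.
pose bad (c : {ffun T -> T}) :=
  `[< (#|F| <= #|pullback c F|)%N /\ ~ P (pullback c F) >].
have bad_id : bad [ffun x => x].
  apply/asboolP; rewrite (@eq_pullback _ _ _ id) ?pullback_id //.
  by move=> x; rewrite ffunE.
case: (arg_maxnP Phi bad_id) => c /asboolP[Fc notPc] c_max.
apply: (notPc); apply: base => // x y cxy; apply/negP => nonadj.
have no_gain x' y' : c x' != c y' -> nonadjacent (pullback c F) x' y' ->
    (#|pullback c F| <= #|pullback (move_to c x' y') F|)%N ->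
    (Phi (move_to c x' y') <= Phi c)%N.
  move=> cxy' nonadj' le'; apply: c_max; apply/asboolP; split.
    exact: leq_trans le'.
  by move=> Pm; apply: (notPc); apply: step Pm; rewrite ?Fc.
have cyx : c y != c x by rewrite eq_sym.
have nonadj' : nonadjacent (pullback c F) y x.
  apply/forall_inP => e eP; rewrite andbC.
  by have /forall_inP/(_ e eP) := nonadj.
have gain x' y' : c x' != c y' -> nonadjacent (pullback c F) x' y' ->
    (#|star (pullback c F) x'| <= #|star (pullback c F) y'|)%N ->
    (#|star (pullback c F) x'| < #|star (pullback c F) y'|)%N ||
    (class_size c (c x') <= class_size c (c y'))%N -> False.
  move=> cxy' nonadj'' star_le' strict.
  have edges := card_move_to cxy' nonadj''.
  have pairs := twin_pairs_move_to cxy'.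
  have bound := twin_pairs_le c.
  have := no_gain _ _ cxy' nonadj'' ; rewrite /Phi.
  move: edges pairs bound strict star_le'.
  move: #|pullback c F| #|pullback (move_to c x' y') F| => e e'.
  move: (twin_pairs (move_to c x' y')) (twin_pairs c) (class_size c (c x'))
        (class_size c (c y')) => q' q u v.
  move: #|star (pullback c F) x'| #|star (pullback c F) y'| (#|T| * #|T| ^ 2)%N => a b M.
  move=> edges pairs bound strict ab /(_ _).
  have [ltab|leba] := ltnP a b.
    have lt_e : (e < e')%N by lia.
    move/(_ (ltnW lt_e)).
    have : (e.+1 * M.+1 <= e' * M.+1)%N by rewrite leq_mul2r lt_e orbT.
    by rewrite mulSn; lia.
  have -> : e' = e by lia.
  have uv : (u <= v)%N by case/orP: strict => //; rewrite ltnNge leba.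
  by rewrite leq_add2l => /(_ (leqnn _)); lia.
case: (ltngtP #|star (pullback c F) x| #|star (pullback c F) y|) => [lt|gt|eq].
- by apply: (gain x y) => //; rewrite ?lt // ltnW.
- by apply: (gain y x) => //; rewrite ?gt // ltnW.
- have [le|/ltnW le] := leqP (class_size c (c x)) (class_size c (c y)).
    by apply: (gain x y) => //; rewrite ?eq // le orbT.
  by apply: (gain y x) => //; rewrite ?eq // le orbT.
Qed.

(** * Stability *)

(** The image of [c], with the edges of [E] inside it, is the graph of classes
    of [pullback c E]; it covers pairs as soon as vertices in distinct classes
    are adjacent. *)
Lemma covering_core (FF : hypergraph_family) (FF_clonable : clonable FF)
  (T : finType) (E : {set {set T}}) (c : T -> T) :
  FF T E -> (forall x y, c x != c y -> ~~ nonadjacent (pullback c E) x y) ->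
  exists (S : finType) (G : {set {set S}}) (d : T -> S),
    [/\ covering_pairs FF G, forall v, exists x, d x = v &
        pullback d G = pullback c E].
Proof.
move=> FE cover; pose d x : {y | y \in codom c} := exist _ (c x) (codom_f c x).
have dE : pullback d (pullback (val : {y | y \in codom c} -> T) E) = pullback c E.
  by rewrite pullback_comp; apply: eq_pullback.
have d_surj v : exists x, d x = v.
  case: v => v vc; have /codomP[x vx] := vc; exists x.
  by apply/val_inj; rewrite /= vx.
exists _, (pullback (val : {y | y \in codom c} -> T) E), d; split=> //.
split=> [|u v uv]; first exact: clonable_pullback.
have [[x xu] [y yv]] := (d_surj u, d_surj v).
have cxy : c x != c y by apply: contra uv => /eqP cE; rewrite -xu -yv; apply/eqP/val_inj.
have := cover x y cxy; rewrite negb_forall => /existsP[e].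
rewrite negb_imply negbK -dE in_pullback => /andP[/andP[eE _] /andP[xe ye]].
by exists (d @: e) => //; rewrite -xu -yv !imset_f.
Qed.

Section LocalStability.
Variables (R : realType) (r : nat) (FF HH : hypergraph_family).
Variables (eps alpha : R) (T : finType).
Hypothesis local : forall E : {set {set T}}, FF E ->
  (edit_dist R HH E <= (eps * #|T|%:R ^+ r)%:E)%E ->
  (#|E|%:R%:E <= (max_edges HH #|T|)%:R%:E - alpha%:E * edit_dist R HH E)%E.

(** Local stability in terms of an attained, hence real, edit distance. *)
Lemma local_stability_edit (E H0 : {set {set T}}) :
  FF E -> HH H0 -> #|symdiff E H0|%:R <= eps * #|T|%:R ^+ r ->
  exists H, [/\ HH H, edit_dist R HH E = #|symdiff E H|%:R%:E &
    #|E|%:R + alpha * #|symdiff E H|%:R <= (max_edges HH #|T|)%:R].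
Proof.
move=> FE HH0 close.
have dist_le : (edit_dist R HH E <= #|symdiff E H0|%:R%:E)%E by exact: edit_dist_le.
have [|H HHH distE] := @edit_dist_attained R HH T E.
  by apply: le_lt_trans dist_le _; exact: ltry.
exists H; split=> //; have := local FE.
rewrite distE -EFinM -EFinB !lee_fin => /(_ (le_trans _ close)).
by rewrite lerBrDr; apply; rewrite distE lee_fin in dist_le.
Qed.

End LocalStability.

Theorem theorem5p1 (R : realType) (r : nat) (FF HH : hypergraph_family)
  (FF_rgraphs : rgraph_family r FF) (HH_rgraphs : rgraph_family r HH)
  (FF_clonable : clonable FF) (HH_clonable : clonable HH)
  (FFstar_stable : weakly_weight_stable R HH (covering_pairs FF))
  (FF_locally_stable : locally_stable R r HH FF) :
  stable R r HH FF.
Proof.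
have [eps [alpha [eps_gt0 alpha_gt0 [n1 local]]]] := FF_locally_stable.
have eps8 : 0 < eps / 8 by lra.
have [delta delta_gt0 weak] := FFstar_stable _ eps8.
have delta2 : 0 < delta / 2 by lra.
have [n2 max_ge] := max_edges_ge HH_rgraphs HH_clonable delta2.
(* [beta] is small enough for [m - beta * N] edges to trigger weak weight
   stability, and for local stability to push distances below [eps / 2]. *)
pose beta := Num.min (delta / 2) (alpha * eps / 4).
have beta_gt0 : 0 < beta.
  by rewrite lt_min delta2 /= divr_gt0 // mulr_gt0.
have beta_delta : beta <= delta / 2 by rewrite ge_min lexx.
have beta_alpha : beta <= alpha * eps / 4 by rewrite ge_min lexx orbT.
(* [n >= 4 / eps] makes the cost [2 * n ^ (r - 1)] of one move at most
   [eps / 2 * n ^ r]. *)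
have e4_ge0 : 0 <= 4 / eps by rewrite divr_ge0 // ltW.
exists (Num.min alpha beta); first by rewrite lt_min alpha_gt0.
exists (maxn n1 (maxn n2 (Num.bound (4 / eps)).+1)) => T E FE.
rewrite !geq_max => /and3P[n1_le n2_le n3_le] dist_le.
have T_gt0 : (0 < #|T|)%N by apply: leq_trans n3_le.
have local_T := fun A FA => local T A FA n1_le.
set N : R := #|T|%:R ^+ r in dist_le *.
have N_ge0 : 0 <= N by rewrite exprn_ge0.
have [|H0 HH0 distE] := @edit_dist_attained R HH T E.
  by apply: le_lt_trans dist_le _; exact: ltry.
have mge := max_ge _ n2_le; rewrite -/N in mge.
set m : R := (max_edges HH #|T|)%:R in mge.
pose near (A : {set {set T}}) :=
  exists2 H, HH T H & #|symdiff A H|%:R <= eps / 2 * N.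
rewrite distE -EFinM -EFinB lee_fin -/m.
have sd_le : #|symdiff E H0|%:R <= N.
  rewrite /N -natrX ler_nat; apply: card_uniform_le; apply: uniform_symdiff.
    exact: FF_rgraphs.1 FE.
  exact: HH_rgraphs.1 HH0.
have min_alpha : Num.min alpha beta <= alpha by rewrite ge_min lexx.
have min_beta : Num.min alpha beta <= beta by rewrite ge_min lexx orbT.
have [sparse|dense] := leP #|E|%:R (m - beta * N).
  apply: le_trans sparse _; rewrite lerD2l lerN2.
  by rewrite ler_pM // le_min ?ltW.
have [H HHH closeH] : near E.
  apply: symmetrization.
  - move=> c x y cxy nonadj /andP[le_c _] [H HHH close].
    have FP := clonable_pullback FF_clonable c FE.
    have small : #|symdiff (pullback c E) H|%:R <= eps * N.
      have tri := symdiff_triangle (pullback c E) (pullback (move_to c x y) E) H.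
      have mv := symdiff_move_to cxy nonadj.
      have unifP := FF_rgraphs.1 _ _ FP.
      have sx := star_le x unifP; have sy := star_le y unifP.
      have T_gt0' : 0 < #|T|%:R :> R by rewrite ltr0n.
      have nT : 4 <= eps * #|T|%:R.
        have := lt_trans (archi_boundP e4_ge0) (_ : _ < #|T|%:R :> R).
        rewrite ltr_nat n3_le => /(_ isT) /ltW.
        by rewrite ler_pdivrMr // mulrC.
      move: mv tri sx sy; rewrite -!(ler_nat R) !natrD !natrM natrX -/N.
      move=> mv tri sx sy.
      have star_small (a : R) : 0 <= a -> a * #|T|%:R <= N -> a <= eps / 4 * N.
        move=> a_ge0 aN; have : a * 4 <= a * (eps * #|T|%:R) by rewrite ler_wpM2l.
        have : eps * (a * #|T|%:R) <= eps * N by rewrite ler_wpM2l // ltW.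
        lra.
      have := star_small _ (ler0n _ _) sx; have := star_small _ (ler0n _ _) sy.
      lra.
    (* Local stability improves [eps] to [eps / 2], since the graph is within
       [beta * N] of the maximum and [beta <= alpha * eps / 4]. *)
    have [H1 [HH1 _ edges]] := local_stability_edit local_T FP HHH small.
    exists H1 => //; rewrite -/m in edges.
    move: le_c; rewrite -(ler_nat R) => le_c.
    have : alpha * #|symdiff (pullback c E) H1|%:R <= alpha * (eps / 2 * N).
      have : beta * N <= alpha * eps / 4 * N by rewrite ler_wpM2r.
      have : 0 <= alpha * eps * N by rewrite !mulr_ge0 // ltW.
      lra.
    by rewrite ler_pM2l.
  - move=> c le_c cover.
    have [S [G [d [[FG coverG] d_surj dE]]]] := covering_core FF_clonable FE cover.
    have N_gt0 : 0 < N by rewrite exprn_gt0 // ltr0n.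
    (* The losses [delta / 2] from [max_edges_ge] and [beta] from [dense] add up
       to at most [delta]. *)
    have close : (family_weighted_dist HH G (class_weight R d) <= (eps / 8)%:E)%E.
      apply: weak; [by [] | exact: class_weight_distribution |].
      have := @card_pullback_class_weight R r T S d T_gt0 G (FF_rgraphs.1 _ _ FG).
      move: le_c; rewrite dE -(ler_nat R) -/N => le_c dens_ge.
      have : beta * N <= delta / 2 * N by rewrite ler_wpM2r.
      move=> beta_N; rewrite -(ler_pM2r N_gt0); lra.
    have [|H HHH symH] := edit_le_weighted_dist d_surj T_gt0 FF_rgraphs HH_rgraphs
      HH_clonable (e := eps / 4) FG.
      apply: le_lt_trans close _; rewrite lte_fin; lra.
    exists H => //; rewrite -dE; apply: le_trans symH _; rewrite -/N.
    by rewrite ler_wpM2r //; lra.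
have [|H1 [HH1 distE1 edges]] := local_stability_edit local_T FE HHH.
  by apply: le_trans closeH _; rewrite -/N ler_wpM2r //; lra.
have -> : #|symdiff E H0|%:R = #|symdiff E H1|%:R :> R.
  by move: distE1; rewrite distE => -[].
rewrite lerBrDr; apply: le_trans edges; rewrite lerD2l.
by rewrite ler_wpM2r.
Qed.
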